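(* Let $k,l,m$ be positive integers with $\gcd(k,l,m)=1$ and let $\tau_{k,l,m}(n)$ be the number of spanning trees of $Y(n;k,l,m)$. Then $$\tau_{k,l,m}(n)\sim\frac{n}{k^2+l^2+m^2}A_{k,l,m}^{\,n},\qquad n\to\infty,$$ where $A_{k,l,m}=|a_0|\prod_{P(z)=0,\,|z|>1}|z|$, the product being over the roots (with multiplicity) of the Laurent polynomial $P(z)=3abc-ab-ac-bc$ with $a=3-z^k-z^{-k}$, $b=3-z^l-z^{-l}$, $c=3-z^m-z^{-m}$, and $a_0$ is the leading coefficient of $P(z)$.
   Context: The $Y$-graph $Y(n;k,l,m)$ is the (multi)graph with vertices $v_{x,y}$, $x\in\{0,1,2,3\}$, $y\in\mathbb{Z}_n$, and edges $v_{1,y}v_{1,y+k}$, $v_{2,y}v_{2,y+l}$, $v_{3,y}v_{3,y+m}$ and $v_{i,y}v_{0,y}$ ($i=1,2,3$) for all $y\in\mathbb{Z}_n$, indices mod $n$. The roots of the Laurent polynomial $P$ are the roots of the polynomial $z^{k+l+m}P(z)$, and the leading coefficient of $P$ is the coefficient of $z^{k+l+m}$. The notation $f(n)\sim g(n)$ means $f(n)/g(n)\to1$. *)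

(* Defs.v *)
From HB Require Import structures.
From mathcomp Require Import all_boot all_order all_algebra.
From mathcomp Require Import all_classical all_reals all_analysis.
From mathcomp Require Import complex.
From mathcomp Require Import ring.

Set Implicit Arguments.
Unset Strict Implicit.
Unset Printing Implicit Defensive.

Import Order.TTheory GRing.Theory Num.Theory.
Import numFieldNormedType.Exports.

(* A finite multigraph is given by finite types V (vertices) and E (edges) and
   the map sending an edge to its two ends, listed in an irrelevant order.
   Loops and parallel edges are allowed, and parallel edges are distinct
   elements of E. *)
Section Multigraph.
Variables (V E : finType) (ends : E -> V * V).

Definition joins (e : E) (u v : V) : bool :=
  (ends e == (u, v)) || (ends e == (v, u)).

Definition adjacent (T : {set E}) : rel V :=
  [rel u v | [exists e in T, joins e u v]].

Definition spans (T : {set E}) : bool :=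
  [forall u, forall v, connect (adjacent T) u v].

(* The list (u_1, e_1), ..., (u_r, e_r) stands for the closed walk in which e_i
   joins u_i to u_(i+1), and e_r joins u_r to u_1. A loop is a cycle with r = 1,
   and two parallel edges form a cycle with r = 2. *)
Definition is_cycle (c : seq (V * E)) : bool :=
  [&& c != [::], uniq (unzip1 c), uniq (unzip2 c) &
      path.cycle (fun p q => joins p.2 p.1 q.1) c].

Definition acyclic (T : {set E}) : Prop :=
  forall c : seq (V * E), is_cycle c -> ~ {subset unzip2 c <= T}.

Definition spanning_tree (T : {set E}) : Prop := spans T /\ acyclic T.

Definition num_spanning_trees : nat := #|[set T : {set E} | `[< spanning_tree T >]]|.

End Multigraph.

Fact rotate_subproof n (k : nat) (y : 'I_n) : (y + k) %% n < n.
Proof. by rewrite ltn_pmod // (leq_ltn_trans _ (ltn_ord y)). Qed.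

Definition rotate n (k : nat) (y : 'I_n) : 'I_n := Ordinal (rotate_subproof k y).

(* The vertex v_{x,y} is the pair (x, y). *)
Definition Yvertex (n : nat) : finType := ('I_4 * 'I_n)%type.

(* The index i in {1,2,3} is represented by j : 'I_3 with i = lift ord0 j = j+1. *)
Definition Yedge (n : nat) : finType := (('I_3 * 'I_n) + ('I_3 * 'I_n))%type.

Definition Yends (n k l m : nat) (e : Yedge n) : Yvertex n * Yvertex n :=
  match e with
  | inl (j, y) =>
      ((lift ord0 j, y), (lift ord0 j, rotate (nth 0 [:: k; l; m] j) y))
  | inr (j, y) => ((lift ord0 j, y), (ord0, y))
  end.

Definition tau (k l m n : nat) : nat := num_spanning_trees (@Yends n k l m).

Local Open Scope ring_scope.

Section Growth.
Variable R : realType.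

Definition laurent_factor (k : nat) (z : R[i]) : R[i] := 3 - z ^+ k - z ^- k.

Definition laurentP (k l m : nat) (z : R[i]) : R[i] :=
  let a := laurent_factor k z in
  let b := laurent_factor l z in
  let c := laurent_factor m z in
  3 * a * b * c - a * b - a * c - b * c.

(* z^k (3 - z^k - z^(-k)) as a polynomial *)
Definition cleared_factor (k : nat) : {poly R[i]} := 3 *: 'X^k - 'X^(2 * k)%N - 1.

(* z^(k+l+m) P(z) as a polynomial *)
Definition clearedP (k l m : nat) : {poly R[i]} :=
  let a := cleared_factor k in
  let b := cleared_factor l in
  let c := cleared_factor m in
  3 *: (a * b * c) - 'X^m * (a * b) - 'X^l * (a * c) - 'X^k * (b * c).

Lemma cleared_factorE k (z : R[i]) : z != 0 ->
  (cleared_factor k).[z] = z ^+ k * laurent_factor k z.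
Proof.
move=> z0; rewrite /cleared_factor /laurent_factor.
rewrite !(hornerD, hornerN, hornerZ, hornerXn, hornerC).
rewrite !mulrBr divff ?expf_neq0 // -exprD addnn -mul2n.
by ring.
Qed.

Lemma clearedPE k l m (z : R[i]) : z != 0 ->
  (clearedP k l m).[z] = z ^+ (k + l + m) * laurentP k l m z.
Proof.
move=> z0; rewrite /clearedP /laurentP; cbv zeta.
have := cleared_factorE k z0; have := cleared_factorE l z0.
have := cleared_factorE m z0.
move: (cleared_factor k) (cleared_factor l) (cleared_factor m) => a b c ec eb ea.
rewrite !(hornerD, hornerN, hornerZ, hornerM, hornerXn) ea eb ec.
by rewrite !exprD; ring.
Qed.

(* The coefficient of z^(k+l+m) in P(z) is that of z^(2(k+l+m)) in
   z^(k+l+m) P(z). *)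
Definition leadP (k l m : nat) : R[i] := (clearedP k l m)`_(2 * (k + l + m))%N.

(* The roots of p, each listed as often as its multiplicity *)
Definition poly_roots (p : {poly R[i]}) : seq R[i] :=
  sval (closed_field_poly_normal p).

Lemma poly_rootsP (p : {poly R[i]}) :
  p = lead_coef p *: \prod_(z <- poly_roots p) ('X - z%:P).
Proof. exact: svalP (closed_field_poly_normal p). Qed.

(* Normc.normc is the R-valued modulus on R[i]. *)
Definition growth (k l m : nat) : R :=
  Normc.normc (leadP k l m) *
  \prod_(z <- poly_roots (clearedP k l m) | 1 < Normc.normc z) Normc.normc z.

Definition asymp_equiv (f g : nat -> R) : Prop :=
  ((fun n => f n / g n) @ \oo --> (1 : R))%classic.

End Growth.

(* Main.v *)
(* By the matrix-tree theorem (obtained from Cauchy-Binet), det(L + u^T u) is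
   (sum u)^2 times the number of spanning trees, where L is the Laplacian. For
   u the indicator of the n central vertices, L + u^T u is a 4 x 4 array of
   circulant matrices, and the discrete Fourier transform gives
     n tau(n) = prod_(x^n = 1, x <> 1) P(x).
   At 1 all of a, b, c equal 1 and P has a double zero: z^(k+l+m) P(z) is
   (z - 1)^2 q(z) with q(1) = - (k^2 + l^2 + m^2). Exchanging the product over
   roots of unity with the product over the roots of q yields the exact formula
     tau(n) = n |a_0|^n prod_(q(z) = 0) |z^n - 1| / (k^2 + l^2 + m^2).
   On the unit circle a, b, c >= 1 and P = bc(a - 1) + ac(b - 1) + ab(c - 1), so
   P vanishes there only where z^k = z^l = z^m = 1, i.e. at z = 1; hence no root
   of q has modulus 1 and |z^n - 1| ~ max(1, |z|)^n for each of them. *)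
From mathcomp Require Import all_classical all_reals all_analysis.
From mathcomp Require Import all_boot all_order all_fingroup all_algebra.
From mathcomp Require Import separable cyclotomic.
From mathcomp Require Import complex ring lra zify.
Require Import Defs.

Set Implicit Arguments.
Unset Strict Implicit.
Unset Printing Implicit Defensive.

Import Order.TTheory GRing.Theory Num.Theory.
Import numFieldNormedType.Exports.

(** * Spanning trees *)

Section SpanningTrees.
Variables (V E : finType) (ends : E -> V * V).
Implicit Types (T : {set E}) (e : E) (u v : V).

Lemma joins_sym e u v : joins ends e u v = joins ends e v u.
Proof. by rewrite /joins orbC. Qed.

Lemma adjacentP T u v :
  reflect (exists2 e, e \in T & joins ends e u v) (adjacent ends T u v).
Proof. exact: exists_inP. Qed.

Lemma adjacent_connect_sym T : connect_sym (adjacent ends T).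
Proof.
apply: sym_connect_sym => u v; apply/adjacentP/adjacentP => -[e eT];
  by rewrite joins_sym; exists e.
Qed.

(** The codomain is an arbitrary type, so that the invariant may be a Boolean, as membership in a
    vertex set, or a proposition. *)
Lemma connect_eq (rT : Type) (x : V -> rT) T u v :
    (forall e, e \in T -> x (ends e).1 = x (ends e).2) ->
  connect (adjacent ends T) u v -> x u = x v.
Proof.
move=> xT /connectP[p]; elim: p u => [|w p IHp] u /=; first by move=> _ ->.
case/andP=> /adjacentP[e eT euw] pw vp; rewrite -(IHp w) //.
by case/orP: euw (xT e eT) => /eqP ->.
Qed.

Lemma connect_sub_edges T T' u v : T \subset T' ->
  connect (adjacent ends T) u v -> connect (adjacent ends T') u v.
Proof.
move=> /subsetP sTT'; apply: connect_sub => {}u {}v /adjacentP[e eT euv].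
by apply: connect1; apply/adjacentP; exists e => //; apply: sTT'.
Qed.

Lemma spansP T : reflect (forall u v, connect (adjacent ends T) u v) (spans ends T).
Proof.
apply: (iffP forallP) => [T1 u v | T1 u]; first exact: forallP (T1 u) v.
by apply/forallP.
Qed.

(* A vertex set U containing r and a tree T0 on it grow together, each time by an
   edge of T leaving U. *)
Lemma spanning_subset T (r : V) : spans ends T ->
  exists T0 : {set E}, [/\ T0 \subset T, spans ends T0 & #|T0|.+1 = #|V|].
Proof.
move=> /spansP spT.
suff: forall i, i < #|V| -> exists (U : {set V}) (T0 : {set E}),
    [/\ #|U| = i.+1, #|T0| = i, T0 \subset T,
        forall e, e \in T0 -> ((ends e).1 \in U) && ((ends e).2 \in U)
      & forall u, u \in U -> connect (adjacent ends T0) r u].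
  have V0 : 0 < #|V| by apply/card_gt0P; exists r.
  move=> /(_ #|V|.-1); rewrite prednK // leqnn => /(_ isT)[U [T0 [cU cT sT _ rU]]].
  exists T0; split=> //; last by rewrite cT prednK.
  have UT u : u \in U.
    by have /eqP -> : U == setT by rewrite eqEcard subsetT cardsT cU leqnn.
  apply/spansP => u v; apply: (@connect_trans _ _ r); last exact/rU/UT.
  by rewrite adjacent_connect_sym; apply/rU/UT.
elim=> [|i IHi] ltiV.
  exists [set r], set0; split; rewrite ?cards1 ?cards0 ?sub0set //.
    by move=> e; rewrite in_set0.
  by move=> u /set1P ->; apply: connect0.
have [|U [T0 [cU cT sT TU rU]]] := IHi; first exact: ltnW.
have /exists_inP[e eT] : [exists e in T, ((ends e).1 \in U) != ((ends e).2 \in U)].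
  (* Otherwise membership in [U] is constant along [T], which makes [U] all of [V] although it has
     only [i.+1] elements. *)
  apply/contraT; rewrite negb_exists_in => /forall_inP cl.
  suff : #|V| <= #|U| by rewrite cU leqNgt ltiV.
  rewrite -cardsT; apply/subset_leq_card/subsetP => v _.
  have /card_gt0P[w wU] : 0 < #|U| by rewrite cU.
  rewrite -(@connect_eq _ (fun x => x \in U) T w v) //.
  by move=> e /cl; rewrite negbK => /eqP.
wlog [u [v [euv uU vU]]] : / exists u v, [/\ joins ends e u v, u \in U & v \notin U].
  have [ue|ue] := boolP ((ends e).1 \in U) => IH ne; apply: IH => //;
    rewrite eq_sym in ne.
    exists (ends e).1, (ends e).2; split=> //; last by move: ne; case: (_ \in U).
    by rewrite /joins -surjective_pairing eqxx.
  exists (ends e).2, (ends e).1; split=> //; last by move: ne; case: (_ \in U).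
  by rewrite /joins -surjective_pairing eqxx orbT.
move=> _; have eT0 : e \notin T0.
  apply: contra vU => /TU; move: euv => /orP[] /eqP -> /=; by case/andP.
exists (v |: U), (e |: T0); split.
- by rewrite cardsU1 vU cU.
- by rewrite cardsU1 eT0 cT.
- by rewrite subUset sub1set eT.
- move=> f /setU1P[->|/TU/andP[f1 f2]]; last by rewrite !inE f1 f2 !orbT.
  by case/orP: euv => /eqP ->; rewrite !inE eqxx uU ?orbT.
have sub := subsetUr [set e] T0.
move=> w /setU1P[->|/rU/(connect_sub_edges sub) //].
apply: connect_trans (connect_sub_edges sub (rU u uU)) (connect1 _).
by apply/adjacentP; exists e => //; rewrite setU11.
Qed.

Let step (p q : V * E) := joins ends p.2 p.1 q.1.

Lemma walk_of_path T u p : path (adjacent ends T) u p -> uniq (u :: p) ->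
  exists c : seq (V * E),
    [/\ unzip1 c = belast u p, uniq (unzip2 c), {subset unzip2 c <= T},
        forall e, e \in unzip2 c -> ((ends e).1 \in u :: p) && ((ends e).2 \in u :: p)
      & forall a e, joins ends a.2 a.1 u -> path step a (rcons c (last u p, e))].
Proof.
elim: p u => [|v p IHp] u; first by exists [::]; split=> //= a e au; rewrite /step au.
rewrite [path _ _ _]/= => /andP[/adjacentP[e eT euv] vp] /andP[u_vp Uvp].
have [c [c1 c2 cT cp cW]] := IHp v vp Uvp.
have ec : e \notin unzip2 c.
  apply: contra u_vp => /cp; move: euv => /orP[] /eqP -> /=; by case/andP.
exists ((u, e) :: c); split=> //=.
- by rewrite c1.
- by rewrite ec.
- by move=> f; rewrite inE => /orP[/eqP -> | /cT].
- move=> f; rewrite inE => /orP[/eqP -> | /cp/andP[f1 f2]]; last first.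
    by rewrite in_cons f1 in_cons f2 !orbT.
  by case/orP: euv => /eqP ->; rewrite !inE !eqxx !orbT.
by move=> a f au; rewrite /step /= au /=; apply: cW.
Qed.

(** Membership in [T] is asked of the edges of [c] alone, so that the edge of [a] may be one just
    removed: the rest of a cycle still connects its ends. *)
Lemma connect_of_walk T a b c : path step a (rcons c b) ->
    {subset unzip2 c <= T} ->
  exists2 v, joins ends a.2 a.1 v & connect (adjacent ends T) v b.1.
Proof.
elim: c a => [|d c IHc] a /=; first by rewrite andbT => ab _; exists b.1.
case/andP=> ad dc sT; exists d.1 => //.
have [|v dv vb] := IHc d dc; first by move=> f fc; apply: sT; rewrite inE fc orbT.
apply: connect_trans (connect1 _) vb; apply/adjacentP; exists d.2 => //.
by apply: sT; rewrite mem_head.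
Qed.

(** An edge outside the subset given by [spanning_subset] would close a cycle; conversely, an edge
    on a cycle could be removed, leaving a spanning set with too few edges. The vertex [r] excludes
    the empty graph, where the count fails. *)
Lemma spanning_treeP T (r : V) :
  spanning_tree ends T <-> spans ends T /\ #|T|.+1 = #|V|.
Proof.
split=> [[spT acT] | [spT cT]]; split=> //.
  have [T0 [sT0 /spansP spT0 <-]] := spanning_subset r spT.
  suff -> : T = T0 by [].
  apply/eqP; rewrite eqEsubset sT0 andbT; apply: contraT => /subsetPn[e eT eT0].
  have /connectP[p0 pp lp] := spT0 (ends e).2 (ends e).1.
  case/shortenP: pp lp => p pp Up _ lp.
  have [c [c1 c2 cT _ cW]] := walk_of_path pp Up.
  case: (acT ((last (ends e).2 p, e) :: c)); last first.
    move=> f; rewrite inE => /orP[/eqP -> //| /cT]; exact: subsetP sT0 f.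
  apply/and4P; split=> //=.
  - by rewrite c1; move: Up; rewrite lastI rcons_uniq.
  - by rewrite c2 andbT; apply: contra eT0 => /cT.
  by apply: cW => /=; rewrite -lp /joins -surjective_pairing eqxx.
move=> [|[u e] c] // /and4P[_ _ /= /andP[ec _] cyc] cT'.
have eT : e \in T by apply: cT'; rewrite mem_head.
have [|v /= uv vu] := @connect_of_walk (T :\ e) _ _ _ cyc.
  move=> f fc; rewrite !inE cT' ?inE ?fc ?orbT // andbT.
  by apply: contra ec => /eqP <-.
have spTe : spans ends (T :\ e).
  apply/spansP => x y; move/spansP: spT => /(_ x y); apply: connect_sub.
  move=> {}x {}y /adjacentP[f fT fxy]; have [fe|fe] := eqVneq f e; last first.
    by apply: connect1; apply/adjacentP; exists f; rewrite // !inE fe.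
  move: fxy uv; rewrite fe /joins => /orP[]/eqP -> /orP[]/eqP[-> ->] //;
  by rewrite adjacent_connect_sym.
have [T0 [sT0 _ cT0]] := spanning_subset r spTe.
have := subset_leq_card sT0; rewrite -ltnS cT0 -cT (cardsD1 e T) eT.
by rewrite ltnn.
Qed.

End SpanningTrees.

Local Open Scope ring_scope.

(** * The matrix-tree theorem *)

Lemma big_option (R : Type) (idx : R) (op : Monoid.com_law idx) (I : finType)
    (F : option I -> R) :
  \big[op/idx]_i F i = op (F None) (\big[op/idx]_i F (Some i)).
Proof.
rewrite (bigD1 None) //=; congr (op _ _).
rewrite (reindex_omap Some id) => [|[]] //.
by apply: eq_bigl => i; rewrite eqxx.
Qed.

(** * Determinants of Gram matrices *)

Section Gram.
Variables (R : comNzRingType) (N : nat) (I : finType) (C : I -> 'rV[R]_N).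

(* A symmetrised Cauchy-Binet formula: the sum runs over all maps f rather than
   over N-subsets of I, so each subset is counted N! times. *)
Lemma det_gram :
  (N`!)%:R * \det (\sum_i (C i)^T *m C i) =
  \sum_(f : {ffun 'I_N -> I}) \det (\matrix_a C (f a)) ^+ 2.
Proof.
set G := \sum_i _; pose M (f : {ffun 'I_N -> I}) := \matrix_a C (f a).
have detG : \det G = \sum_(f : {ffun 'I_N -> I}) (\prod_a M f a a) * \det (M f).
  transitivity (\sum_(s : 'S_N) \sum_(f : {ffun 'I_N -> I})
      (-1) ^+ s * \prod_a (M f a a * M f a (s a))).
    apply: eq_bigr => s _; rewrite -big_distrr /=; congr (_ * _).
    transitivity (\prod_a \sum_i (C i 0 a * C i 0 (s a))).
      apply: eq_bigr => a _; rewrite /G summxE; apply: eq_bigr => i _.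
      by rewrite mxE big_ord1 !mxE.
    rewrite bigA_distr_bigA /=; apply: eq_bigr => f _; apply: eq_bigr => a _.
    by rewrite !mxE.
  rewrite exchange_big; apply: eq_bigr => f _; rewrite big_distrr /=.
  by apply: eq_bigr => s _; rewrite big_split /= mulrCA.
(* Precomposing [f] with [s] permutes the rows of [M f]. Summed over all [s], these expressions for
   the same [\det G] build a second determinant of [M f]. *)
have detGs (s : 'S_N) : \det G =
    \sum_(f : {ffun 'I_N -> I}) \det (M f) * ((-1) ^+ s * \prod_a M f (s a) a).
  rewrite detG (reindex (fun f : {ffun 'I_N -> I} => [ffun a => f (s a)])) /=.
    apply: eq_bigr => f _.
    have -> : M [ffun a => f (s a)] = row_perm s (M f).
      by apply/matrixP => a b; rewrite !mxE ffunE.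
    rewrite row_permE det_mulmx det_perm mulrC -mulrA mulrCA.
    do 2!congr (_ * _); apply: eq_bigr => a _.
    by rewrite -row_permE !mxE.
  exists (fun f : {ffun 'I_N -> I} => [ffun a => f ((s^-1)%g a)]) => f _;
    by apply/ffunP => a; rewrite !ffunE ?permKV ?permK.
transitivity (\sum_(s : 'S_N) \det G).
  by rewrite sumr_const mulr_natl -card_Sn.
rewrite (eq_bigr _ (fun s _ => detGs s)) exchange_big; apply: eq_bigr => f _.
rewrite -big_distrr expr2 /=; congr (_ * _); rewrite -det_tr.
by apply: eq_bigr => s _; congr (_ * _); apply: eq_bigr => a _; rewrite !mxE.
Qed.

End Gram.

(** The two products in [e] are equal, and their triangular blocks have the two sides as
    determinants. *)
Lemma det_1D_col_row (R : comNzRingType) n (c : 'cV[R]_n) (r : 'rV[R]_n) :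
  \det (1%:M + c *m r) = 1 + (r *m c) 0 0.
Proof.
have e : block_mx 1%:M 0 c 1%:M *m block_mx 1%:M (- r) 0 (1%:M + c *m r) =
         block_mx (1%:M + r *m c) (- r) 0 1%:M *m block_mx 1%:M 0 c 1%:M.
  rewrite !mulmx_block !mulmx1 !mul1mx !mul0mx !mulmx0 ?addr0 ?add0r !mulNmx.
  by rewrite addrK mulmxN addrCA addNr addr0.
have := congr1 determinant e.
rewrite !det_mulmx !det_lblock !det_ublock !det1 !mul1r !mulr1 => ->.
by rewrite det_mx11 !mxE.
Qed.

(** * Determinants of the Laplacian and spanning trees *)

Section MatrixTree.
Variables (V E : finType) (ends : E -> V * V) (N : nat) (h : 'I_N -> V).
Hypothesis bij_h : bijective h.

Definition point_row (v : V) : 'rV[int]_N := \row_a (v == h a)%:R.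

(** A row of the signed incidence matrix. The sign depends on the order of the ends but cancels in
    [laplacian]; a loop gives the zero row. *)
Definition edge_row (e : E) : 'rV[int]_N :=
  point_row (ends e).1 - point_row (ends e).2.

Definition laplacian : 'M[int]_N := \sum_e (edge_row e)^T *m edge_row e.

Lemma sum_point_row v (x : 'cV[int]_N) a : v = h a -> (point_row v *m x) 0 0 = x a 0.
Proof.
move=> ->; rewrite mxE (bigD1 a) //= big1 => [|b ba]; rewrite !mxE.
  by rewrite eqxx mul1r addr0.
by rewrite (inj_eq (bij_inj bij_h)) eq_sym (negbTE ba) mul0r.
Qed.

Lemma edge_row_mul e (x : V -> int) :
  edge_row e *m (\col_a x (h a)) = (x (ends e).1 - x (ends e).2)%:M.
Proof.
have [g hg gh] := bij_h; rewrite [LHS]mx11_scalar mulmxBl; congr _%:M.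
rewrite mxE (@sum_point_row _ _ (g (ends e).1)) ?gh // mxE [X in _ + X]mxE.
by rewrite (@sum_point_row _ _ (g (ends e).2)) ?gh // mxE !gh.
Qed.

Section Root.
Variable r : 'I_N.

(* The index None adds to the signed incidence matrix a row supported at the root
   r, so that a spanning tree gives a square matrix of determinant 1 or -1. *)
Definition rooted_row (o : option E) : 'rV[int]_N :=
  if o is Some e then edge_row e else point_row (h r).

Definition edges_of (f : {ffun 'I_N -> option E}) : {set E} :=
  [set e | Some e \in codom f].

Definition root_tree_map (f : {ffun 'I_N -> option E}) : bool :=
  [&& injectiveb f, None \in codom f & spans ends (edges_of f)].

(** A repeated row kills the determinant. So does a kernel vector constant along the chosen edges:
    the constant 1 if the root row is missing, the indicator of the vertices not reached from the
    root if the edges do not span. Otherwise the rows generate all unit rows over the integers, so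
    the determinant is a unit, 1 or -1. *)
Lemma det_rooted_rows (f : {ffun 'I_N -> option E}) :
  \det (\matrix_a rooted_row (f a)) ^+ 2 = (root_tree_map f)%:R.
Proof.
set M := \matrix_a _; have [g hg gh] := bij_h.
have det0 (x : V -> int) v : x v != 0 -> M *m (\col_a x (h a)) = 0 -> \det M = 0.
  move=> xv Mx; apply/eqP; rewrite -det_tr; apply/det0P.
  exists (\col_a x (h a))^T; last by rewrite -trmx_mul Mx trmx0.
  by apply: contra xv => /eqP/rowP/(_ (g v)); rewrite !mxE gh => ->.
rewrite /root_tree_map.
have [/injectiveP inj_f | /injectivePn[a [b ab fab]]] := boolP (injectiveb f);
  last first.
  rewrite (@determinant_alternate _ _ _ a b) ?expr0n // => c.
  by rewrite !mxE fab.
have [Nf | Nf] := boolP (None \in codom f); last first.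
  rewrite (@det0 (fun=> 1) (h r)) ?expr0n ?oner_eq0 //.
  apply/row_matrixP => a; rewrite row_mul rowK row0.
  case fa : (f a) => [e|]; last by rewrite -fa codom_f in Nf.
  by rewrite /= (edge_row_mul e (fun=> 1)) subrr raddf0.
have [spT | nspT] := boolP (spans _ _) => /=; last first.
  have [v rv] : exists v, ~~ connect (adjacent ends (edges_of f)) (h r) v.
    apply/existsP; apply: contraT; rewrite negb_exists => /forallP all_v.
    case/negP: nspT; apply/spansP => u v.
    apply: (@connect_trans _ _ (h r)); first rewrite adjacent_connect_sym.
      exact/negbNE/all_v.
    exact/negbNE/all_v.
  pose x v := (~~ connect (adjacent ends (edges_of f)) (h r) v)%:R : int.
  rewrite (@det0 x v) ?expr0n // /x ?rv //.
  apply/row_matrixP => a; rewrite row_mul rowK row0.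
  case fa : (f a) => [e|] /=.
    rewrite (edge_row_mul e x).
    suff -> : x (ends e).1 = x (ends e).2 by rewrite subrr raddf0.
    rewrite /x; congr (nat_of_bool (~~ _))%:R.
    apply: same_connect_r; first exact: adjacent_connect_sym.
    apply: connect1; apply/adjacentP; exists e.
      by rewrite inE -fa codom_f.
    by rewrite /joins -surjective_pairing eqxx.
  rewrite [LHS]mx11_scalar (@sum_point_row _ _ r) // !mxE connect0.
  by rewrite raddf0.
pose P v := exists y : 'rV_N, y *m M = point_row v.
have Prow a : exists y : 'rV_N, y *m M = rooted_row (f a).
  by exists (delta_mx 0 a); rewrite -rowE rowK.
have Pr : P (h r) by have [a fa] := codomP Nf; have := Prow a; rewrite -fa.
(* The rows span all of Z^N: along an edge of the tree, point_row changes by a row. *)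
have PV v : P v.
  suff <- : P (h r) = P v by [].
  move/spansP: spT => /(_ (h r) v); apply: connect_eq => e.
  rewrite inE => /codomP[a fa].
  have [y yM] := Prow a; rewrite -fa /= in yM.
  rewrite propeqE; split=> -[z zM].
    by exists (z - y); rewrite mulmxBl yM zM /edge_row opprB addrCA subrr addr0.
  by exists (z + y); rewrite mulmxDl yM zM /edge_row addrCA subrr addr0.
have [y yM] := fin_all_exists (fun a => PV (h a)).
have /(congr1 determinant) : (\matrix_a y a) *m M = 1%:M.
  apply/row_matrixP => a; rewrite row_mul rowK yM row1.
  by apply/rowP => b; rewrite !mxE (inj_eq (bij_inj bij_h)) eq_sym.
rewrite det_mulmx det1 => /intUnitRing.unitzPl/orP[]/eqP ->; by rewrite ?sqrrN expr1n.
Qed.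

(** A tree has [N - 1] edges, so with the root row there are exactly [N] rows to arrange. The
    resulting factorial cancels the one in [det_gram]. *)
Lemma card_root_tree_maps (T : {set E}) : spanning_tree ends T ->
  #|[set f | root_tree_map f && (edges_of f == T)]| = N`!.
Proof.
move=> /(spanning_treeP _ _ (h r))[spT cT].
have cV : #|V| = N by rewrite -(bij_eq_card bij_h) card_ord.
pose A : pred (option E) := fun o => if o is Some e then e \in T else true.
have cA : #|A| = N.
  rewrite -cV -cT -[LHS]sum1_card big_mkcond big_option /= add1n; congr _.+1.
  by rewrite -sum1_card [RHS]big_mkcond.
have <- : #|A| ^_ #|'I_N| = N`! by rewrite cA card_ord ffactnn.
rewrite -card_inj_ffuns_on; apply: eq_card => f; rewrite !inE.
apply/idP/idP.
  case/andP=> /and3P[inj_f Nf _] /eqP fT; rewrite inj_f andbT.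
  apply/ffun_onP => a; rewrite unfold_in; case fa : (f a) => [e|] //=.
  by rewrite -fT inE -fa codom_f.
case/andP=> /ffun_onP fA inj_f; rewrite /root_tree_map inj_f /=.
(* An injection between sets of the same size [N] is onto, so the root row and every edge of [T]
   occur. *)
have fE : codom f =i A.
  apply/subset_cardP; last by apply/subsetP => o /codomP[a ->].
  by rewrite card_codom ?card_ord //; apply/injectiveP.
have -> : edges_of f = T by apply/setP => e; rewrite inE fE.
by rewrite fE eqxx spT.
Qed.

Lemma det_rooted_laplacian :
  \det (laplacian + (point_row (h r))^T *m point_row (h r)) =
  (num_spanning_trees ends)%:R.
Proof.
have N0 : (N`!)%:R != 0 :> int by rewrite pnatr_eq0 -lt0n fact_gt0.
apply: (mulfI N0); rewrite addrC.
have -> : (point_row (h r))^T *m point_row (h r) + laplacian =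
    \sum_o (rooted_row o)^T *m rooted_row o by rewrite big_option.
rewrite det_gram (eq_bigr _ (fun f _ => det_rooted_rows f)).
rewrite -natr_sum -natrM; congr _%:R.
rewrite -big_mkcond /= (partition_big edges_of (fun T => `[< spanning_tree ends T >])).
  rewrite /num_spanning_trees -sum1_card big_distrr /=.
  apply: eq_big => [T|T /asboolP treeT]; first by rewrite inE.
  by rewrite muln1 -(card_root_tree_maps treeT) -sum1_card;
    apply: eq_bigl => f; rewrite inE.
move=> f /and3P[/injectiveP inj_f Nf spT]; apply/asboolP.
apply/(spanning_treeP _ _ (h r)); split=> //.
rewrite -(bij_eq_card bij_h) -(card_codom inj_f) -[RHS]sum1_card.
rewrite [RHS]big_mkcond big_option /= Nf add1n; congr _.+1.
by rewrite -sum1_card [LHS]big_mkcond; apply: eq_bigr => e _; rewrite inE.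
Qed.

End Root.

(** The matrix [K] fixes every edge row, because edge rows annihilate the all-ones column, and it
    sends the root row to [u]. Congruence by [K] thus reduces to the rooted case, at the cost of the
    square of its determinant. *)
Theorem matrix_tree (r : 'I_N) (u : 'rV[int]_N) :
  \det (laplacian + u^T *m u) = (\sum_a u 0 a) ^+ 2 * (num_spanning_trees ends)%:R.
Proof.
pose one : 'cV[int]_N := const_mx 1.
pose K := 1%:M + one *m (u - point_row (h r)).
have one_h : one = \col_a (fun _ : V => 1 : int) (h a).
  by apply/colP => a; rewrite !mxE.
have edgeK e : edge_row e *m K = edge_row e.
  rewrite mulmxDr mulmx1 mulmxA one_h (edge_row_mul e (fun=> 1)) subrr.
  by rewrite raddf0 mul0mx addr0.
have row_one v : point_row v *m one = 1%:M.
  have [g hg gh] := bij_h; rewrite [LHS]mx11_scalar.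
  by rewrite (@sum_point_row _ _ (g v)) ?gh // mxE.
have rootK : point_row (h r) *m K = u.
  by rewrite mulmxDr mulmx1 mulmxA row_one mul1mx addrC subrK.
have detK : \det K = \sum_a u 0 a.
  rewrite det_1D_col_row mulmxBl row_one !mxE addrCA subrr addr0.
  by apply: eq_bigr => a _; rewrite !mxE mulr1.
have -> : laplacian + u^T *m u =
    K^T *m (laplacian + (point_row (h r))^T *m point_row (h r)) *m K.
  clearbody K; rewrite mulmxDr mulmxDl /laplacian mulmx_sumr mulmx_suml; congr (_ + _).
    by apply: eq_bigr => e _; rewrite mulmxA -trmx_mul -mulmxA edgeK.
  by rewrite mulmxA -trmx_mul -mulmxA rootK.
by rewrite !det_mulmx det_tr det_rooted_laplacian detK mulrAC -expr2.
Qed.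

End MatrixTree.

(** * The Laplacian spectrum of the Y-graph *)

Lemma gram_rows (R : comNzRingType) (m n : nat) (M : 'M[R]_(m, n)) :
  M^T *m M = \sum_i (row i M)^T *m row i M.
Proof.
apply/matrixP => a b; rewrite summxE mxE; apply: eq_bigr => i _.
by rewrite [RHS]mxE big_ord1 !mxE.
Qed.

Section GramBlocks.
Variables (R : comNzRingType) (m n1 n2 : nat).

Lemma gram_0row (w : 'M[R]_(m, n2)) :
  (row_mx 0 w)^T *m row_mx 0 w = block_mx (0 : 'M[R]_n1) 0 0 (w^T *m w).
Proof. by rewrite tr_row_mx mul_col_row trmx0 !mul0mx mulmx0. Qed.

Lemma gram_row0 (w : 'M[R]_(m, n1)) :
  (row_mx w 0)^T *m row_mx w 0 = block_mx (w^T *m w) 0 0 (0 : 'M[R]_n2).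
Proof. by rewrite tr_row_mx mul_col_row trmx0 !mul0mx mulmx0. Qed.

Lemma gram_N1row (w : 'M[R]_(m, n2)) :
  (row_mx (- 1%:M) w)^T *m row_mx (- 1%:M) w =
  block_mx 1%:M (- w) (- w^T) (w^T *m w).
Proof.
have trN1 : (- 1%:M : 'M[R]_m)^T = - 1%:M.
  by apply/matrixP => i j; rewrite !mxE eq_sym.
rewrite tr_row_mx mul_col_row trN1 mulNmx mul1mx opprK.
by rewrite mulNmx mul1mx mulmxN mulmx1.
Qed.

End GramBlocks.

(** * Block elimination for a star of square blocks *)

Section Star.
Variables (F : fieldType) (n : nat).
Implicit Types X A B C : 'M[F]_n.

Definition star_mx X A B C : 'M[F]_(n + (n + (n + n))) :=
  block_mx X (row_mx (- 1%:M) (row_mx (- 1%:M) (- 1%:M)))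
    (col_mx (- 1%:M) (col_mx (- 1%:M) (- 1%:M)))
    (block_mx A 0 0 (block_mx B 0 0 C)).

(** Multiplication on the right by the unipotent [U] clears the blocks below [X] and leaves the
    Schur complement in its place. *)
Lemma det_star_mx X A B C :
    A \in unitmx -> B \in unitmx -> C \in unitmx ->
  \det (star_mx X A B C) =
  \det (X - invmx A - invmx B - invmx C) * (\det A * (\det B * \det C)).
Proof.
move=> uA uB uC.
pose U := block_mx 1%:M 0 (col_mx (invmx A) (col_mx (invmx B) (invmx C))) 1%:M
  : 'M[F]_(n + (n + (n + n))).
have detU : \det U = 1 by rewrite det_lblock !det1 mulr1.
rewrite -[LHS]mulr1 -detU -det_mulmx /star_mx mulmx_block.
rewrite !mulmx0 !mulmx1 !add0r !mul_row_col !mul_block_col !mulNmx !mul1mx !mul0mx.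
rewrite !mulmxV // !addr0 !add0r !add_col_mx !addNr !col_mx0 det_ublock.
by rewrite !det_ublock !addrA.
Qed.

End Star.

Section YGraph.
Variables (k l m n : nat).

(** The central vertices come first and then the three rings, so that the Laplacian takes the shape
    of [star_mx]. *)
Definition Yindex (i : 'I_(n + (n + (n + n)))) : Yvertex n :=
  match split i with
  | inl y => (ord0, y)
  | inr i1 => match split i1 with
    | inl y => (lift ord0 ord0, y)
    | inr i2 => match split i2 with
      | inl y => (lift ord0 (lift ord0 ord0), y)
      | inr y => (lift ord0 (lift ord0 (lift ord0 ord0)), y)
      end
    end
  end.

Lemma Yindex_l y : Yindex (lshift _ y) = (ord0, y).
Proof. by rewrite /Yindex (unsplitK (inl y)). Qed.

Lemma Yindex_rl y : Yindex (rshift _ (lshift _ y)) = (lift ord0 ord0, y).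
Proof. by rewrite /Yindex (unsplitK (inr _)) (unsplitK (inl y)). Qed.

Lemma Yindex_rrl y :
  Yindex (rshift _ (rshift _ (lshift _ y))) = (lift ord0 (lift ord0 ord0), y).
Proof. by rewrite /Yindex 2!(unsplitK (inr _)) (unsplitK (inl y)). Qed.

Lemma Yindex_rrr y :
  Yindex (rshift _ (rshift _ (rshift _ y))) =
  (lift ord0 (lift ord0 (lift ord0 ord0)), y).
Proof. by rewrite /Yindex 2!(unsplitK (inr _)) (unsplitK (inr y)). Qed.

Definition YindexE := (Yindex_l, Yindex_rl, Yindex_rrl, Yindex_rrr).

Lemma Yindex_case (P : 'I_(n + (n + (n + n))) -> Prop) :
    (forall y, P (lshift _ y)) -> (forall y, P (rshift _ (lshift _ y))) ->
    (forall y, P (rshift _ (rshift _ (lshift _ y)))) ->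
    (forall y, P (rshift _ (rshift _ (rshift _ y)))) ->
  forall i, P i.
Proof.
move=> P0 P1 P2 P3 i; rewrite -(splitK i); case: (split i) => //= {}i.
rewrite -(splitK i); case: (split i) => //= {}i.
by rewrite -(splitK i); case: (split i).
Qed.

Lemma Yindex_bij : bijective Yindex.
Proof.
apply: inj_card_bij; last by rewrite card_prod !card_ord; lia.
by elim/Yindex_case => y; elim/Yindex_case => z; rewrite !YindexE => -[] // ->.
Qed.

(** The signed incidence matrix of the edges of step [j] on one ring. *)
Definition rot_diff (R : pzRingType) (j : nat) : 'M[R]_n :=
  \matrix_y (delta_mx 0 y - delta_mx 0 (rotate j y)).

(* 3 - S^j - S^-j for the cyclic shift S *)
Definition ring_mx (R : pzRingType) (j : nat) : 'M[R]_n :=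
  1%:M + (rot_diff R j)^T *m rot_diff R j.

Local Notation point_row := (point_row Yindex).
Local Notation edge_row := (edge_row (@Yends n k l m) Yindex).

Lemma point_row0 y : point_row (ord0, y) = row_mx (delta_mx 0 y) 0.
Proof.
apply/rowP; elim/Yindex_case => z;
  by rewrite !(row_mxEl, row_mxEr, mxE) YindexE xpair_eqE //= eq_sym.
Qed.

Lemma point_row1 y :
  point_row (lift ord0 ord0, y) = row_mx 0 (row_mx (delta_mx 0 y) 0).
Proof.
apply/rowP; elim/Yindex_case => z;
  by rewrite !(row_mxEl, row_mxEr, mxE) YindexE xpair_eqE //= eq_sym.
Qed.

Lemma point_row2 y :
  point_row (lift ord0 (lift ord0 ord0), y) =
  row_mx 0 (row_mx 0 (row_mx (delta_mx 0 y) 0)).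
Proof.
apply/rowP; elim/Yindex_case => z;
  by rewrite !(row_mxEl, row_mxEr, mxE) YindexE xpair_eqE //= eq_sym.
Qed.

Lemma point_row3 y :
  point_row (lift ord0 (lift ord0 (lift ord0 ord0)), y) =
  row_mx 0 (row_mx 0 (row_mx 0 (delta_mx 0 y))).
Proof.
apply/rowP; elim/Yindex_case => z;
  by rewrite !(row_mxEl, row_mxEr, mxE) YindexE xpair_eqE //= eq_sym.
Qed.

Lemma sum_edge_rows (M : 'M[int]_(n, n + (n + (n + n)))) (e : 'I_n -> Yedge n) :
    (forall y, edge_row (e y) = row y M) ->
  \sum_y (edge_row (e y))^T *m edge_row (e y) = M^T *m M.
Proof. by move=> eM; rewrite gram_rows; apply: eq_bigr => y _; rewrite eM. Qed.

Lemma sum_Yedge (U : nmodType) (F : Yedge n -> U) :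
  \sum_e F e =
  \sum_y F (inl (ord0, y)) + (\sum_y F (inl (lift ord0 ord0, y)) +
    \sum_y F (inl (lift ord0 (lift ord0 ord0), y))) +
  (\sum_y F (inr (ord0, y)) + (\sum_y F (inr (lift ord0 ord0, y)) +
    \sum_y F (inr (lift ord0 (lift ord0 ord0), y)))).
Proof.
have sumF (c : 'I_3 * 'I_n -> Yedge n) :
    \sum_p F (c p) = \sum_j \sum_y F (c (j, y)).
  by rewrite pair_bigA; apply: eq_bigr => -[].
by rewrite big_sumType /= (sumF inl) (sumF inr) !big_ord_recl !big_ord0 !addr0.
Qed.

(** Each of the six families of edges contributes the Gram matrix of one block row: a single
    rotation difference for a ring, two opposite identity blocks for a set of spokes. The spokes
    give the 3 at the centre and the 1 inside each [ring_mx]. *)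
Lemma Ylaplacian :
  laplacian (@Yends n k l m) Yindex =
  block_mx 3%:M (row_mx (- 1%:M) (row_mx (- 1%:M) (- 1%:M)))
    (col_mx (- 1%:M) (col_mx (- 1%:M) (- 1%:M)))
    (block_mx (ring_mx _ k) 0 0 (block_mx (ring_mx _ l) 0 0 (ring_mx _ m))).
Proof.
rewrite /laplacian sum_Yedge.
pose G := rot_diff int.
rewrite (@sum_edge_rows (row_mx 0 (row_mx (G k) 0))); last first.
  move=> y; rewrite /edge_row /= !point_row1 !row_row_mx !row0 rowK.
  by rewrite !opp_row_mx !add_row_mx !subrr.
rewrite (@sum_edge_rows (row_mx 0 (row_mx 0 (row_mx (G l) 0)))); last first.
  move=> y; rewrite /edge_row /= !point_row2 !row_row_mx !row0 rowK.
  by rewrite !opp_row_mx !add_row_mx !subrr.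
rewrite (@sum_edge_rows (row_mx 0 (row_mx 0 (row_mx 0 (G m))))); last first.
  move=> y; rewrite /edge_row /= !point_row3 !row_row_mx !row0 rowK.
  by rewrite !opp_row_mx !add_row_mx !subrr.
rewrite (@sum_edge_rows (row_mx (- 1%:M) (row_mx 1%:M 0))); last first.
  move=> y; rewrite /edge_row /= point_row0 point_row1 !row_row_mx !row0.
  by rewrite linearN /= row1 !opp_row_mx !add_row_mx !subr0 add0r.
rewrite (@sum_edge_rows (row_mx (- 1%:M) (row_mx 0 (row_mx 1%:M 0)))); last first.
  move=> y; rewrite /edge_row /= point_row0 point_row2 !row_row_mx !row0.
  by rewrite linearN /= row1 !opp_row_mx !add_row_mx !subr0 add0r.
rewrite (@sum_edge_rows (row_mx (- 1%:M) (row_mx 0 (row_mx 0 1%:M)))); last first.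
  move=> y; rewrite /edge_row /= point_row0 point_row3 !row_row_mx !row0.
  by rewrite linearN /= row1 !opp_row_mx !add_row_mx !subr0 add0r.
rewrite ?(gram_N1row, gram_0row, gram_row0) trmx1 !mul1mx.
rewrite !(tr_row_mx, opp_row_mx, opp_col_mx, trmx0, trmx1, oppr0).
rewrite !add_block_mx ?add0r ?addr0.
rewrite !(add_row_mx, add_col_mx, add_block_mx, add0r, addr0) /ring_mx.
have <- : 1%:M + (1%:M + 1%:M) = 3%:M :> 'M[int]_n by rewrite -!raddfD.
by rewrite ![1%:M + _^T *m _]addrC.
Qed.

Lemma map_ring_mx (R : comNzRingType) j :
  map_mx intr (ring_mx int j) = ring_mx R j.
Proof.
have eG : map_mx intr (rot_diff int j) = rot_diff R j.
  by apply/matrixP => a b; rewrite !mxE rmorphB /= !rmorph_nat.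
by rewrite map_mxD map_mxM -map_trmx eG map_mx1.
Qed.

(** The indicator [u] of the central vertices has sum [n], and its rank-one correction adds the
    all-ones matrix to the central block only. That matrix is circulant, so Fourier analysis still
    applies. *)
Lemma tau_det (F : fieldType) : (0 < n)%N ->
  (n ^ 2 * tau k l m n)%:R =
  \det (star_mx (3%:M + const_mx 1) (ring_mx F k) (ring_mx F l) (ring_mx F m)).
Proof.
move=> n0; pose u : 'rV[int]_(n + (n + (n + n))) := row_mx (const_mx 1) 0.
have sum_u : \sum_a u 0 a = n%:R.
  rewrite big_split_ord /= [X in _ + X]big1 => [|a _]; last first.
    by rewrite row_mxEr mxE.
  rewrite addr0 (eq_bigr (fun=> 1)) => [|a _]; first by rewrite sumr_const card_ord.
  by rewrite row_mxEl mxE.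
have := matrix_tree (@Yends n k l m) Yindex_bij (lshift _ (Ordinal n0)) u.
rewrite sum_u Ylaplacian tr_row_mx mul_col_row !trmx0 !mul0mx !mulmx0.
rewrite add_block_mx !addr0 => /(congr1 (fun z : int => z%:~R : F)).
rewrite -det_map_mx !map_block_mx !map_row_mx !map_col_mx !map_ring_mx.
rewrite !map_mx0 !map_mxN !map_mx1 map_mxD map_scalar_mx.
rewrite -natrX -natrM /= !rmorph_nat => <-; congr (\det (block_mx (_ + _) _ _ _)).
by apply/matrixP => a b; rewrite !mxE big_ord1 !mxE.
Qed.

(** * Diagonalisation of circulant blocks by the discrete Fourier transform *)

Section Fourier.
Variables (F : fieldType) (s : seq F).
Hypotheses (size_s : size s = n) (uniq_s : uniq s).
Hypothesis unity_s : forall x, x \in s -> x ^+ n = 1.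

(** The Fourier matrix: each column lists the successive powers of one root of unity. *)
Let W : 'M[F]_n := Vandermonde n (\row_j s`_j).

Lemma nth_unity (j : 'I_n) : s`_j ^+ n = 1.
Proof. by apply/unity_s/mem_nth; rewrite size_s. Qed.

Lemma nth_neq0 (j : 'I_n) : s`_j != 0.
Proof.
apply/eqP => sj0; have := nth_unity j; rewrite sj0 expr0n.
rewrite gtn_eqF ?(leq_ltn_trans _ (ltn_ord j)) // => /eqP.
by rewrite eq_sym oner_eq0.
Qed.

Lemma fourier_unit : W \in unitmx.
Proof.
rewrite unitmxE det_Vandermonde unitfE.
apply/prodf_neq0 => i _; apply/prodf_neq0 => j ij; rewrite !mxE subr_eq0.
by rewrite nth_uniq ?size_s // neq_ltn ij orbT.
Qed.

(** The columns of [W] are eigenvectors of [A], with eigenvalues given as a function of the root. In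
    this form the relation passes to sums, products and inverses. *)
Definition fourier_diag (A : 'M[F]_n) (f : F -> F) :=
  A *m W = W *m diag_mx (\row_j f s`_j).

Lemma fourier_diagP A f :
  (forall y i, (A *m W) y i = s`_i ^+ y * f s`_i) -> fourier_diag A f.
Proof. by move=> eA; apply/matrixP => y i; rewrite eA mul_mx_diag !mxE. Qed.

Lemma rotate_inj j : injective (@rotate n j).
Proof.
move=> x y /(congr1 val) /= /eqP; rewrite eqn_modDr !modn_small //.
by move=> /eqP; apply: val_inj.
Qed.

Lemma exp_rotate j (y i : 'I_n) : s`_i ^+ rotate j y = s`_i ^+ (y + j).
Proof. by rewrite /= expr_mod // nth_unity. Qed.

Lemma rot_diff_fourier j : fourier_diag (rot_diff F j) (fun x => 1 - x ^+ j).
Proof.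
apply: fourier_diagP => y i; transitivity (row y (rot_diff F j *m W) 0 i).
  by rewrite [RHS]mxE.
by rewrite row_mul rowK mulmxBl -!rowE !mxE exp_rotate exprD mulrBr mulr1.
Qed.

Lemma rot_diff_tr_fourier j :
  fourier_diag (rot_diff F j)^T (fun x => 1 - x ^- j).
Proof.
apply: fourier_diagP => y i.
transitivity (\sum_p ((p == y)%:R - (rotate j p == y)%:R) * s`_i ^+ p).
  by rewrite mxE; apply: eq_bigr => p _; rewrite !mxE /= ![_ == y]eq_sym.
have sj0 : s`_i ^+ j != 0 by rewrite expf_neq0 // nth_neq0.
(* Multiplying by the [j]-th power of the root makes the second sum run over rotated indices, where
   [rotate_inj] reindexes it without an inverse rotation. *)
apply: (mulIf sj0); rewrite -mulrA mulrBl mul1r mulVf // big_distrl /=.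
rewrite mulrBr mulr1.
transitivity (\sum_p ((p == y)%:R * s`_i ^+ (p + j) -
    (rotate j p == y)%:R * s`_i ^+ rotate j p)).
  by apply: eq_bigr => p _; rewrite exp_rotate -mulrBl -mulrA exprD.
rewrite sumrB; congr (_ - _).
  by rewrite (bigD1 y) //= eqxx big1 ?mul1r ?addr0 ?exprD // => p /negbTE ->;
    rewrite mul0r.
have <- : \sum_(p < n) (p == y)%:R * s`_i ^+ p =
    \sum_p (rotate j p == y)%:R * s`_i ^+ rotate j p.
  exact: reindex_inj (@rotate_inj j).
by rewrite (bigD1 y) //= eqxx big1 ?mul1r ?addr0 // => p /negbTE ->; rewrite mul0r.
Qed.

Lemma fourier_diagD A B f g : fourier_diag A f -> fourier_diag B g ->
  fourier_diag (A + B) (fun x => f x + g x).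
Proof.
rewrite /fourier_diag => fA gB; rewrite mulmxDl fA gB -mulmxDr -raddfD /=.
by congr (_ *m diag_mx _); apply/rowP => i; rewrite !mxE.
Qed.

Lemma fourier_diagN A f : fourier_diag A f -> fourier_diag (- A) (fun x => - f x).
Proof.
rewrite /fourier_diag => fA; rewrite mulNmx fA -mulmxN -raddfN /=.
by congr (_ *m diag_mx _); apply/rowP => i; rewrite !mxE.
Qed.

Lemma fourier_diagM A B f g : fourier_diag A f -> fourier_diag B g ->
  fourier_diag (A *m B) (fun x => f x * g x).
Proof.
rewrite /fourier_diag => fA gB; rewrite -mulmxA gB mulmxA fA -mulmxA mulmx_diag.
by congr (_ *m diag_mx _); apply/rowP => i; rewrite !mxE.
Qed.

Lemma fourier_scalar c : fourier_diag c%:M (fun=> c).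
Proof.
rewrite /fourier_diag -scalar_mxC -diag_const_mx.
by congr (_ *m diag_mx _); apply/rowP => i; rewrite !mxE.
Qed.

(** The eigenvalue is a geometric sum over a root of unity, which vanishes except at 1. *)
Lemma fourier_const : fourier_diag (const_mx 1) (fun x => (x == 1)%:R * n%:R).
Proof.
apply: fourier_diagP => y i; rewrite mxE.
transitivity (\sum_(p < n) s`_i ^+ p).
  by apply: eq_bigr => p _; rewrite !mxE mul1r.
have [->|si1] := eqVneq; last first.
  apply/eqP; rewrite mul0r mulr0.
  have := subrX1 s`_i n; rewrite nth_unity subrr => /esym/eqP.
  by rewrite mulf_eq0 subr_eq0 (negbTE si1).
rewrite expr1n !mul1r (eq_bigr (fun=> 1)) => [|p _]; last by rewrite expr1n.
by rewrite sumr_const card_ord.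
Qed.

Lemma fourier_det A f : fourier_diag A f -> \det A = \prod_(x <- s) f x.
Proof.
have uW : \det W != 0 by rewrite -unitfE -unitmxE fourier_unit.
move=> /(congr1 determinant); rewrite !det_mulmx mulrC => /(mulfI uW) ->.
rewrite det_diag (big_nth 0) big_mkord size_s.
by apply: eq_bigr => i _; rewrite mxE.
Qed.

Lemma fourier_inv A f : {in s, forall x, f x != 0} -> fourier_diag A f ->
  A \in unitmx /\ fourier_diag (invmx A) (fun x => (f x)^-1).
Proof.
move=> f0 fA; have uA : A \in unitmx.
  rewrite unitmxE unitfE (fourier_det fA).
  by rewrite prodf_seq_neq0; apply/allP => x /f0 ->.
split=> //; apply: (can_inj (mulKmx uA)); rewrite mulmxA mulmxV // mul1mx.
rewrite mulmxA fA -mulmxA mulmx_diag -[LHS]mulmx1 -diag_const_mx.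
congr (_ *m diag_mx _); apply/rowP => i; rewrite !mxE mulfV //.
by apply/f0/mem_nth; rewrite size_s.
Qed.

Lemma ring_mx_fourier j : fourier_diag (ring_mx F j) (fun x => 3 - x ^+ j - x ^- j).
Proof.
have := fourier_diagD (fourier_scalar 1)
  (fourier_diagM (rot_diff_tr_fourier j) (rot_diff_fourier j)).
rewrite /fourier_diag => ->; congr (_ *m diag_mx _); apply/rowP => i; rewrite !mxE.
have sj0 : s`_i ^+ j != 0 by rewrite expf_neq0 // nth_neq0.
by rewrite mulrBl mul1r mulrBr mulr1 mulVf //; ring.
Qed.

(** The Schur complement has eigenvalue 3 - 1/a - 1/b - 1/c, increased by [n] at 1. The factor abc
    from the ring determinants clears the denominators and produces P. *)
Lemma tau_prod (a := fun x : F => 3 - x ^+ k - x ^- k)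
    (b := fun x : F => 3 - x ^+ l - x ^- l) (c := fun x : F => 3 - x ^+ m - x ^- m) :
    (0 < n)%N ->
    {in s, forall x, [&& a x != 0, b x != 0 & c x != 0]} ->
  (n ^ 2 * tau k l m n)%:R = \prod_(x <- s)
    (3 * a x * b x * c x - a x * b x - a x * c x - b x * c x +
     (x == 1)%:R * n%:R * (a x * b x * c x)).
Proof.
move=> n0 abc0.
have [|uA fA] := fourier_inv _ (ring_mx_fourier k); first by move=> x /abc0/and3P[].
have [|uB fB] := fourier_inv _ (ring_mx_fourier l); first by move=> x /abc0/and3P[].
have [|uC fC] := fourier_inv _ (ring_mx_fourier m); first by move=> x /abc0/and3P[].
rewrite (tau_det F n0) (det_star_mx _ uA uB uC).
rewrite (fourier_det (ring_mx_fourier k)) (fourier_det (ring_mx_fourier l)).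
rewrite (fourier_det (ring_mx_fourier m)).
have fX := fourier_diagD (fourier_scalar 3) fourier_const.
have := fourier_diagD (fourier_diagD (fourier_diagD fX (fourier_diagN fA))
  (fourier_diagN fB)) (fourier_diagN fC).
move=> /fourier_det ->; rewrite -!big_split /=; apply: eq_big_seq => x /abc0.
by rewrite -/(a x) -/(b x) -/(c x) => /and3P[a0 b0 c0]; field; rewrite a0 b0 c0.
Qed.

End Fourier.
End YGraph.

(** * The Laurent polynomial P *)

Section Modulus.
Variable R : realType.
Implicit Types (z : R[i]) (s : seq R[i]).
Local Notation normc := (@Normc.normc R).

Lemma normr_normc z : `|z| = (normc z)%:C%C.
Proof. by []. Qed.

Lemma normc_ge0 z : 0 <= normc z.
Proof. by have := normr_ge0 z; rewrite normr_normc lecR. Qed.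

Lemma normc_prod s (P : pred R[i]) (F : R[i] -> R[i]) :
  normc (\prod_(z <- s | P z) F z) = \prod_(z <- s | P z) normc (F z).
Proof.
apply: (big_morph normc) => [z w|]; first exact: Normc.normcM.
exact: Normc.normc1.
Qed.

Lemma normcX z n : normc (z ^+ n) = normc z ^+ n.
Proof.
by elim: n => [|n IHn]; rewrite ?expr0 ?Normc.normc1 // !exprS Normc.normcM IHn.
Qed.

Lemma normc_nat n : normc n%:R = n%:R.
Proof.
have := normr_nat R[i] n; rewrite normr_normc -(rmorph_nat (real_complex R)).
exact: complexI.
Qed.

Lemma normcB z w : normc (z - w) = normc (w - z).
Proof. by rewrite -(opprB w) normcN. Qed.

Lemma normc_eq0 z : (normc z == 0) = (z == 0).
Proof. by apply/eqP/eqP => [/Normc.eq0_normc|->] //; rewrite Normc.normc0. Qed.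

Lemma normc_unity z n : (0 < n)%N -> z ^+ n = 1 -> normc z = 1.
Proof.
move=> n0 zn; apply/eqP; rewrite -(@pexpr_eq1 _ _ n) ?normc_ge0 //.
by rewrite -normcX zn Normc.normc1.
Qed.

(** On the unit circle the inverse is the conjugate, so 2 - z^k - z^(-k) is a squared modulus. *)
Lemma laurent_factor_unit k z : normc z = 1 ->
  laurent_factor k z = 1 + `|1 - z ^+ k| ^+ 2.
Proof.
move=> z1; have nz : `|z| = 1 by rewrite normr_normc z1.
have z0 : z != 0 by rewrite -normr_eq0 nz oner_eq0.
rewrite normCK rmorphB rmorph1 rmorphXn /=.
have -> : Num.conj z = z^-1 by rewrite invC_norm nz expr1n invr1 mul1r.
rewrite exprVn mulrBl mul1r mulrBr mulr1 divff ?expf_neq0 // /laurent_factor.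
by ring.
Qed.

Lemma laurent_factor_neq0 k z : normc z = 1 -> laurent_factor k z != 0.
Proof. by move=> z1; rewrite laurent_factor_unit // gt_eqF // ltr_wpDr ?exprn_ge0. Qed.

Lemma laurentP_unit_eq0 k l m z : gcdn (gcdn k l) m = 1%N ->
  normc z = 1 -> laurentP k l m z = 0 -> z = 1.
Proof.
move=> klm z1; rewrite /laurentP.
have ge0 j : 0 <= `|1 - z ^+ j| ^+ 2 by rewrite exprn_ge0.
have root_of j : `|1 - z ^+ j| ^+ 2 = 0 -> z ^+ j = 1.
  by move/eqP; rewrite expf_eq0 normr_eq0 subr_eq0 => /eqP.
rewrite !laurent_factor_unit //.
move: (ge0 k) (ge0 l) (ge0 m) (@root_of k) (@root_of l) (@root_of m).
move: (`|1 - z ^+ k| ^+ 2) (`|1 - z ^+ l| ^+ 2) (`|1 - z ^+ m| ^+ 2).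
move=> x y t x0 y0 t0 zk zl zm P0.
have pos a b c : 0 <= a -> 0 <= b -> 0 <= c :> R[i] -> 0 <= (1 + a) * (1 + b) * c.
  by move=> a0 b0 c0; rewrite !mulr_ge0 // ?addr_ge0.
(* Here x, y, t stand for a - 1, b - 1, c - 1; all three terms are nonnegative, hence all vanish. *)
have /eqP : (1 + y) * (1 + t) * x + (1 + x) * (1 + t) * y + (1 + x) * (1 + y) * t = 0.
  by rewrite -P0; ring.
rewrite paddr_eq0 ?addr_ge0 ?pos // paddr_eq0 ?pos // -andbA => /and3P[hx hy ht].
have gt a : 0 <= a -> 1 + a != 0 :> R[i] by move=> a0; rewrite gt_eqF // ltr_wpDr.
have mul0 a b c : 0 <= a -> 0 <= b -> (1 + a) * (1 + b) * c == 0 -> c = 0 :> R[i].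
  by move=> a0 b0; rewrite !mulf_eq0 (negbTE (gt _ a0)) (negbTE (gt _ b0)) => /eqP.
have zk1 := zk (mul0 _ _ _ y0 t0 hx).
have zl1 := zl (mul0 _ _ _ x0 t0 hy).
have zm1 := zm (mul0 _ _ _ x0 y0 ht).
(* Bezout over the naturals, a i = b j + gcd, which needs [i] positive; hence the separate case of
   zero. *)
have gcd1 i j : z ^+ i = 1 -> z ^+ j = 1 -> z ^+ gcdn i j = 1.
  move=> zi zj; case: (posnP i) => [->|i0]; first by rewrite gcd0n.
  case: (egcdnP j i0) => a b e _.
  have : z ^+ (a * i) = 1 by rewrite mulnC exprM zi expr1n.
  by rewrite e exprD mulnC exprM zj expr1n mul1r.
by have := gcd1 _ _ (gcd1 _ _ zk1 zl1) zm1; rewrite klm expr1.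
Qed.

End Modulus.

(** * The double zero of P at 1 and the leading coefficient *)

Section ClearedPoly.
Variables (R : realType) (k l m : nat).
Local Notation C := R[i].

(** The left side is X^j - (X^j - 1)^2, and X^j - 1 is X - 1 times a geometric sum. *)
Lemma cleared_factor_sq j :
  cleared_factor R j =
  'X^j - ('X - 1%:P) ^+ 2 * (\sum_(i < j) 'X^i) ^+ 2 :> {poly C}.
Proof.
rewrite -exprMn -subrX1 /cleared_factor scaler_nat mulnC exprM.
by ring.
Qed.

(** This is the polynomial q of the outline. After substituting [cleared_factor_sq] in [clearedP]
    and collecting powers of [E], the constant term cancels; what remains is divided by [E], so the
    last line comes from the linear term. *)
Definition unit_quotient : {poly C} :=
  let E := ('X - 1%:P) ^+ 2 in
  let g j := (\sum_(i < j) 'X^i) ^+ 2 in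
  E * (2 * (g k * g l * 'X^m + g k * g m * 'X^l + g l * g m * 'X^k)
       - 3 * E * (g k * g l * g m))
  - (g k * 'X^l * 'X^m + g l * 'X^k * 'X^m + g m * 'X^k * 'X^l).

Lemma clearedP_quotient : clearedP R k l m = ('X - 1%:P) ^+ 2 * unit_quotient.
Proof.
rewrite /clearedP /unit_quotient !cleared_factor_sq scaler_nat.
by ring.
Qed.

Lemma unit_quotient1 : unit_quotient.[1] = - (k ^ 2 + l ^ 2 + m ^ 2)%N%:R.
Proof.
have g1 j : (\sum_(i < j) 'X^i : {poly C}).[1] = j%:R.
  rewrite horner_sum (eq_bigr (fun=> 1)) ?sumr_const ?card_ord // => i _.
  by rewrite hornerXn expr1n.
rewrite /unit_quotient !(hornerD, hornerN, hornerM, horner_exp, hornerXn, g1).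
rewrite hornerX hornerC subrr expr1n !natrD !natrX !expr1n.
by ring.
Qed.

Lemma size_cleared_factor j : (0 < j)%N ->
  size (cleared_factor R j) = (2 * j).+1 /\ lead_coef (cleared_factor R j) = - 1.
Proof.
move=> j0; have -> : cleared_factor R j = - 'X^(2 * j) + (3 *: 'X^j - 1).
  by rewrite /cleared_factor addrCA addrA.
have sz : (size (3 *: 'X^j - 1 : {poly C})%R < size (- 'X^(2 * j) : {poly C})%R)%N.
  rewrite size_polyN size_polyXn; apply: leq_ltn_trans (size_polyD _ _) _.
  rewrite gtn_max size_polyN size_poly1.
  by rewrite (leq_ltn_trans (size_scale_leq _ _)) ?size_polyXn; lia.
rewrite size_polyDl // lead_coefDl // lead_coefN lead_coefXn size_polyN.
by rewrite size_polyXn.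
Qed.

(** Only the triple product reaches degree 2(k+l+m): in each other term a power X^j replaces a
    factor of degree 2j, which is a strict loss since j is positive. The leading coefficient is
    therefore -3. *)
Lemma lead_clearedP : (0 < k)%N -> (0 < l)%N -> (0 < m)%N ->
  lead_coef (clearedP R k l m) = leadP R k l m /\ leadP R k l m != 0.
Proof.
move=> k0 l0 m0; have [sa la] := size_cleared_factor k0.
have [sb lb] := size_cleared_factor l0; have [sc lc] := size_cleared_factor m0.
rewrite /leadP /clearedP.
move: (cleared_factor R k) (cleared_factor R l) (cleared_factor R m) sa la sb lb sc lc.
move=> a b c sa la sb lb sc lc; cbv zeta.
have nz (p : {poly C}) j : size p = j.+1 -> p != 0.
  by move=> e; rewrite -size_poly_eq0 e.
have [[a0 b0] c0] := (nz _ _ sa, nz _ _ sb, nz _ _ sc).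
have sabc : size (3 *: (a * b * c)) = (2 * (k + l + m)).+1.
  rewrite size_scale ?pnatr_eq0 // !size_mul ?mulf_neq0 // sa sb sc; lia.
have labc : lead_coef (3 *: (a * b * c)) = - 3.
  by rewrite lead_coefZ !lead_coefM la lb lc; ring.
have bound (p q : {poly C}) j i h : size p = (2 * i).+1 -> size q = (2 * h).+1 ->
    (0 < j)%N -> (j + i + h)%N = (k + l + m)%N ->
    (size (- ('X^j * (p * q))) < (2 * (k + l + m)).+1)%N.
  move=> sp sq j0 e; rewrite size_polyN; apply: leq_ltn_trans (size_polyMleq _ _) _.
  rewrite size_polyXn; have := size_polyMleq p q; rewrite sp sq.
  move: (size (p * q)) => x; rewrite addSn addnS /=; lia.
have -> : 3 *: (a * b * c) - 'X^m * (a * b) - 'X^l * (a * c) - 'X^k * (b * c) =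
  3 *: (a * b * c) + (- ('X^m * (a * b)) - 'X^l * (a * c) - 'X^k * (b * c)).
  by rewrite !addrA.
set rest := (X in _ + X); have srest : (size rest < size (3 *: (a * b * c)))%N.
  rewrite sabc; apply: leq_ltn_trans (size_polyD _ _) _; rewrite gtn_max.
  rewrite (@bound _ _ _ _ _ sb sc) ?andbT //.
  apply: leq_ltn_trans (size_polyD _ _) _; rewrite gtn_max.
  rewrite (@bound _ _ _ _ _ sa sb) ?(@bound _ _ _ _ _ sa sc) //; lia.
have -> : (2 * (k + l + m))%N = (size (3 *: (a * b * c) + rest)).-1.
  by rewrite size_polyDl // sabc.
by rewrite -lead_coefE lead_coefDl // labc oppr_eq0 pnatr_eq0.
Qed.

Lemma lead_unit_quotient : (0 < k)%N -> (0 < l)%N -> (0 < m)%N ->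
  lead_coef unit_quotient = leadP R k l m.
Proof.
move=> k0 l0 m0; have [<- _] := lead_clearedP k0 l0 m0.
by rewrite clearedP_quotient lead_coef_monicM // monic_exp // monicXsubC.
Qed.

End ClearedPoly.

(** In characteristic zero X^n - 1 is separable, so its roots are distinct. *)
Lemma unity_roots (R : realType) n : (0 < n)%N ->
  exists s : seq R[i],
    [/\ uniq s, size s = n & 'X^n - 1 = \prod_(x <- s) ('X - x%:P)].
Proof.
move=> n0; have [s] := closed_field_poly_normal ('X^n - 1 : {poly R[i]}).
have mon : lead_coef ('X^n - 1 : {poly R[i]}) = 1 by rewrite lead_coefXnsubC.
rewrite mon scale1r => es; exists s; split=> //.
  rewrite -separable_prod_XsubC -es; apply: separable_Xn_sub_1.
  by rewrite pnatr_eq0 -lt0n.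
by apply/succn_inj; rewrite -(size_prod_XsubC _ id) -es size_XnsubC.
Qed.

(** * The number of spanning trees in terms of the roots of q *)

Section Count.
Variables (R : realType) (k l m n : nat) (s : seq R[i]).
Hypotheses (k0 : (0 < k)%N) (l0 : (0 < l)%N) (m0 : (0 < m)%N) (n0 : (0 < n)%N).
Hypotheses (uniq_s : uniq s) (size_s : size s = n).
Hypothesis prod_s : 'X^n - 1 = \prod_(x <- s) ('X - x%:P).
Local Notation C := R[i].
Local Notation normc := (@Normc.normc R).

Lemma unity_rootP x : (x \in s) = (x ^+ n == 1).
Proof.
by rewrite -root_prod_XsubC -prod_s rootE !hornerE subr_eq0.
Qed.

Lemma normc_unity_root x : x \in s -> normc x = 1.
Proof. by rewrite unity_rootP => /eqP; apply: normc_unity. Qed.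

(** At 1 all of a, b, c equal 1 and P vanishes, so the factor there is [n] alone and cancels one of
    the two factors [n]. *)
Lemma tau_laurentP :
  (n * tau k l m n)%:R = \prod_(x <- s | x != 1) laurentP k l m x.
Proof.
have s1 : 1 \in s by rewrite unity_rootP expr1n.
have nC : n%:R != 0 :> C by rewrite pnatr_eq0 -lt0n.
apply: (mulfI nC); rewrite -natrM mulnA mulnn.
rewrite (@tau_prod k l m n C s size_s uniq_s _ n0); first last.
- by move=> x /normc_unity_root x1; rewrite !laurent_factor_neq0.
- by move=> x; rewrite unity_rootP => /eqP.
rewrite (bigD1_seq 1) //= eqxx mul1r !expr1n !invr1; congr (_ * _); first by ring.
by apply: eq_bigr => x /negbTE ->; rewrite !mul0r addr0.
Qed.

(** The cofactor of X - 1 in X^n - 1; it evaluates products over the nontrivial roots of unity. *)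
Let h : {poly C} := \prod_(x <- s | x != 1) ('X - x%:P).

Lemma unity_prodE : h = \sum_(i < n) 'X^i.
Proof.
have s1 : 1 \in s by rewrite unity_rootP expr1n.
have X1 : 'X - 1%:P != 0 :> {poly C} by rewrite polyXsubC_eq0.
by apply: (mulfI X1); rewrite -subrX1 prod_s (bigD1_seq 1).
Qed.

Lemma unity_prod1 : h.[1] = n%:R.
Proof.
rewrite unity_prodE horner_sum (eq_bigr (fun=> 1)) ?sumr_const ?card_ord // => i _.
by rewrite hornerXn expr1n.
Qed.

Lemma unity_prodM z : (z - 1) * h.[z] = z ^+ n - 1.
Proof.
rewrite unity_prodE horner_sum subrX1; congr (_ * _).
by apply: eq_bigr => i _; rewrite hornerXn.
Qed.

(** The values of q at the roots of unity and those of [h] at the roots of q share one double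
    product of distances. The factor (x - 1)^2 of P contributes h(1)^2, that is n^2, and the sum of
    squares is the modulus of q(1), which supplies the missing factors z - 1. Passing to moduli
    removes signs and the powers x^(k+l+m). *)
Lemma normc_tau_quotient :
  (n * tau k l m n)%:R * (k ^ 2 + l ^ 2 + m ^ 2)%:R =
  normc (leadP R k l m) ^+ n * n%:R ^+ 2 *
    \prod_(z <- poly_roots (unit_quotient R k l m)) normc (z ^+ n - 1).
Proof.
set q := unit_quotient R k l m; set A := leadP R k l m; set r := poly_roots q.
have q_lead : lead_coef q = A by exact: lead_unit_quotient.
have qE x : normc q.[x] = normc A * \prod_(z <- r) normc (x - z).
  rewrite [q in LHS]poly_rootsP q_lead hornerZ Normc.normcM horner_prod normc_prod.
  by congr (_ * _); apply: eq_bigr => z _; rewrite !hornerE.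
have q1 : (k ^ 2 + l ^ 2 + m ^ 2)%:R = normc A * \prod_(z <- r) normc (z - 1).
  rewrite -normc_nat -normcN -unit_quotient1 qE; congr (_ * _).
  by apply: eq_bigr => z _; rewrite normcB.
have normh z : \prod_(x <- s | x != 1) normc (x - z) = normc h.[z].
  rewrite horner_prod normc_prod; apply: eq_bigr => x _.
  by rewrite !hornerE normcB.
have size_s1 : count (fun x => x != 1) s = n.-1.
  have := count_predC (pred1 1) s.
  by rewrite count_uniq_mem // unity_rootP expr1n eqxx size_s add1n => <-.
have -> : (n * tau k l m n)%:R =
    normc A ^+ n.-1 * n%:R ^+ 2 * \prod_(z <- r) normc h.[z].
  rewrite -normc_nat tau_laurentP normc_prod.
  transitivity (\prod_(x <- s | x != 1)
      (normc A * normc (x - 1) ^+ 2 * \prod_(z <- r) normc (x - z))).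
    rewrite big_seq_cond [RHS]big_seq_cond; apply: eq_bigr => x /andP[xs x1].
    have nx := normc_unity_root xs.
    have x0 : x != 0 by rewrite -normc_eq0 nx oner_eq0.
    have : normc (clearedP R k l m).[x] = normc (laurentP k l m x).
      by rewrite clearedPE // Normc.normcM normcX nx expr1n mul1r.
    move=> <-; rewrite clearedP_quotient hornerM Normc.normcM qE !hornerE /=.
    by rewrite normcX; ring.
  rewrite !big_split /= big_const_seq size_s1 iter_mulr_1 exchange_big /=.
  rewrite normh unity_prod1 normc_nat.
  by congr (_ * _); apply: eq_bigr => z _; rewrite normh.
(* The roots of unity other than 1 give [n - 1] leading coefficients; the value of q at 1 gives the
   last one. *)
have -> : normc A ^+ n = normc A * normc A ^+ n.-1 by rewrite -exprS prednK.
rewrite q1.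
under [in RHS]eq_bigr do rewrite -unity_prodM Normc.normcM.
by rewrite big_split /=; ring.
Qed.

End Count.

(** * Asymptotics *)

Section Limit.
Variables (R : realType) (k l m : nat).
Hypotheses (k0 : (0 < k)%N) (l0 : (0 < l)%N) (m0 : (0 < m)%N).
Local Notation C := R[i].
Local Notation normc := (@Normc.normc R).
Let q := unit_quotient R k l m.
Let r := poly_roots q.
Let A := leadP R k l m.

Lemma sum_sq_neq0 (F : numDomainType) : (k ^ 2 + l ^ 2 + m ^ 2)%N%:R != 0 :> F.
Proof. by rewrite pnatr_eq0 -lt0n !addn_gt0 expn_gt0 k0. Qed.

(** A root of q on the unit circle is a zero of P there, hence equals 1; but q(1) is nonzero. *)
Lemma quotient_root_normc z : gcdn (gcdn k l) m = 1%N -> z \in r -> normc z != 1.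
Proof.
move=> klm zr; apply/eqP => z1.
have z0 : z != 0 by rewrite -normc_eq0 z1 oner_eq0.
have /rootP qz : root q z.
  have [_ A0] := lead_clearedP R k0 l0 m0.
  by rewrite [q]poly_rootsP lead_unit_quotient // rootZ // root_prod_XsubC.
have /eqP : (clearedP R k l m).[z] = 0 by rewrite clearedP_quotient hornerM qz mulr0.
rewrite clearedPE // mulf_eq0 expf_eq0 (negbTE z0) andbF /= => /eqP Pz.
have e1 := laurentP_unit_eq0 klm z1 Pz.
move: qz; rewrite e1 unit_quotient1 => /eqP.
by rewrite oppr_eq0 (negbTE (sum_sq_neq0 _)).
Qed.

(** The roots of [clearedP] are those of q and twice the root 1, whose modulus is not above 1. *)
Lemma growth_quotient :
  growth R k l m = normc A * \prod_(z <- r | 1 < normc z) normc z.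
Proof.
rewrite /growth -/A; congr (_ * _).
have [leadE A0] := lead_clearedP R k0 l0 m0.
have q_lead : lead_coef q = A by exact: lead_unit_quotient.
have perm : perm_eq (poly_roots (clearedP R k l m)) (1 :: 1 :: r).
  apply: prod_XsubC_eq; apply: (scalerI A0).
  rewrite -{1}leadE -poly_rootsP clearedP_quotient -/q [q]poly_rootsP q_lead.
  by rewrite !big_cons -scalerAr mulrA -expr2.
by rewrite (perm_big _ perm) /= !big_cons Normc.normc1 ltxx.
Qed.

(** By the triangle inequality the quotient differs from 1 by at most the smaller of |z|^n and 1
    over the larger, which is v^n with v below 1. *)
Lemma cvg_normc_expB1 (z : C) : normc z != 1 ->
  ((fun n => normc (z ^+ n - 1) / (if 1 < normc z then normc z else 1) ^+ n)
     @ \oo --> (1 : R))%classic.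
Proof.
set w := normc z => w1; have w0 : 0 <= w := normc_ge0 z.
have tri (x y : C) : normc x <= normc (x - y) + normc y.
  by rewrite -{1}(subrK y x); apply: le_normcD.
pose v := if 1 < w then w^-1 else w.
have v1 : `|v| < 1.
  rewrite /v; case: (ltP 1 w) => [lt1w|le].
    by rewrite ger0_norm ?invr_ge0 // invf_lt1 // (lt_trans _ lt1w).
  by rewrite ger0_norm // lt_neqAle w1.
have cv : ((fun n => v ^+ n) @ \oo --> (0 : R))%classic by exact: cvg_expr.
apply: (@squeeze_cvgr _ _ _ _ (fun n => 1 - v ^+ n) (fun n => 1 + v ^+ n)).
- apply: nearW => n.
  have t1 := tri (z ^+ n) 1; have t2 := tri 1 (z ^+ n).
  have t3 : normc (z ^+ n - 1) <= w ^+ n + 1.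
    by have := le_normcD (z ^+ n) (- 1); rewrite normcN normcX Normc.normc1.
  rewrite normcB normcX Normc.normc1 -/w in t2.
  rewrite normcX Normc.normc1 -/w in t1.
  rewrite /v; case: (ltP 1 w) => [lt1w|le]; last by rewrite expr1n divr1; lra.
  have wn : 0 < w ^+ n by rewrite exprn_gt0 // (lt_trans _ lt1w).
  rewrite exprVn ler_pdivlMr // ler_pdivrMr // mulrBl mulrDl mulVf ?gt_eqF //.
  by rewrite mul1r; lra.
- by have := cvgB (cvg_cst (1 : R)) cv; rewrite subr0; apply.
- by have := cvgD (cvg_cst (1 : R)) cv; rewrite addr0; apply.
Qed.

Lemma cvg_prod_seq (T : eqType) (s : seq T) (f : T -> nat -> R) :
    {in s, forall z, (f z @ \oo --> (1 : R))%classic} ->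
  ((fun n => \prod_(z <- s) f z n) @ \oo --> (1 : R))%classic.
Proof.
elim: s => [|z s IHs] fs.
  by under eq_fun do rewrite big_nil; apply: cvg_cst.
under eq_fun do rewrite big_cons.
have cz : (f z @ \oo --> (1 : R))%classic by apply: fs; rewrite mem_head.
have cs := IHs (fun x xs => fs x (mem_behead (xs : x \in behead (z :: s)))).
by have := cvgM cz cs; rewrite mulr1; apply.
Qed.

(** The exact formula cancels everything but a product over the roots of q. This list does not
    depend on [n], so the limit can be taken factor by factor. *)
Lemma tau_ratio n : (0 < n)%N ->
  (tau k l m n)%:R / (n%:R / (k ^ 2 + l ^ 2 + m ^ 2)%N%:R * growth R k l m ^+ n) =
  \prod_(z <- r) (normc (z ^+ n - 1) / (if 1 < normc z then normc z else 1) ^+ n).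
Proof.
move=> n0; have [s [uniq_s size_s prod_s]] := unity_roots R n0.
have := normc_tau_quotient k0 l0 m0 n0 uniq_s size_s prod_s.
rewrite -/q -/r -/A growth_quotient => eq_tau.
have nR : n%:R != 0 :> R by rewrite pnatr_eq0 -lt0n.
have QR := sum_sq_neq0 R.
have [_ A0] := lead_clearedP R k0 l0 m0; rewrite -/A -normc_eq0 in A0.
rewrite big_split /= prodfV prodrXl -big_mkcond /=.
set B := \prod_(z <- r | _) normc z; set D := \prod_(z <- r) _ in eq_tau *.
have B0 : B != 0.
  rewrite prodf_seq_neq0; apply/allP => z _; apply/implyP => z1.
  by rewrite gt_eqF // (lt_trans _ z1).
move: ((k ^ 2 + l ^ 2 + m ^ 2)%:R : R) QR eq_tau => Q Q0.
rewrite natrM exprMn; move: (normc A ^+ n) (B ^+ n) (expf_neq0 n A0) (expf_neq0 n B0).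
move: (tau k l m n)%:R n%:R nR => t N N0 An Bn An0 Bn0 eq_tau.
have -> : t = An * N * D / Q.
  by apply: (mulfI N0); apply: (mulIf Q0); rewrite eq_tau; field.
by field; rewrite Q0 N0 An0 Bn0.
Qed.

End Limit.

Theorem theorem4 (R : realType) (k l m : nat)
    (hk : (0 < k)%N) (hl : (0 < l)%N) (hm : (0 < m)%N)
    (hgcd : gcdn (gcdn k l) m = 1%N) :
  asymp_equiv (fun n : nat => (tau k l m n)%:R : R)
    (fun n : nat => n%:R / (k ^ 2 + l ^ 2 + m ^ 2)%N%:R * growth R k l m ^+ n).
Proof.
rewrite /asymp_equiv.
have lim := @cvg_prod_seq R _ _ _ (fun z zr =>
  cvg_normc_expB1 (quotient_root_normc hk hl hm hgcd zr)).
apply: cvg_trans lim; apply: near_eq_cvg.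
(* The exact ratio is available for positive [n], hence the threshold 1. *)
by exists 1%N => // n n0; rewrite /= (tau_ratio R hk hl hm n0).
Qed.
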